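(* Let $n\geq 1$ be an integer, let $p\geq 5$ be a prime, and let $q$ be any prime power. Let $S$ be a Sylow $p$-subgroup of the unitary group $\mathrm{U}_n(\mathbb{F}_q)$. Then $J(S)\leq \mathfrak{X}(S)$.
   Context: For a prime power $q$, $\mathbb{F}_{q^2}$ has the field automorphism $x\mapsto \overline{x}=x^q$ of order $2$; for a matrix $A=(a_{ij})$ write $\overline{A}=(\overline{a_{ij}})$. The unitary group is $\mathrm{U}_n(\mathbb{F}_q)=\{A\in \mathrm{GL}_n(\mathbb{F}_{q^2}) : \overline{A}^{T}A=I_n\}$ (equivalently, up to isomorphism, $\{A : \overline{A}^T Q_n A=Q_n\}$, where $Q_n$ is the $n\times n$ matrix with $1$ on the skew-diagonal and $0$ elsewhere). For a finite $p$-group $S$: the Thompson subgroup $J(S)$ is the subgroup generated by all elementary abelian $p$-subgroups of $S$ whose rank equals the $p$-rank of $S$. Commutators: $[x,y]=x^{-1}y^{-1}xy$, $[X,Y;1]=[X,Y]$, $[X,Y;k]=[[X,Y;k-1],Y]$. $\Omega_1(H)$ is the subgroup generated by elements of order $p$ in $H$. The Oliver subgroup $\mathfrak{X}(S)$ is the unique largest normal subgroup $K$ of $S$ admitting a chain $1=Q_0\leq Q_1\leq\cdots\leq Q_k=K$ of normal subgroups of $S$ such that $[\Omega_1(C_S(Q_{i-1})),Q_i;p-1]=1$ for each $1\leq i\leq k$ (such a chain is called a $Q$-series). *)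

(* Defs.v *)
From HB Require Import structures.
From mathcomp Require Import all_boot all_order all_algebra all_fingroup all_solvable all_field.
Set Implicit Arguments. Unset Strict Implicit. Unset Printing Implicit Defensive.
Import GRing.Theory.
Local Open Scope group_scope.

(* Unitary group U_n(F_q) realised inside GL_n(F), where F is a finite field
   with q^2 elements and conjugation is the Frobenius x |-> x^q.
   {'GL_n[F]} consists of invertible n.-1.+1 square matrices (n >= 1). *)
Definition unitary_group (F : finFieldType) (q n : nat) : {set {'GL_n[F]}} :=
  [set u : {'GL_n[F]} |
    ((map_mx (fun x : F => (x ^+ q)%R) (GLval u))^T *m GLval u == 1%:M)%R].

Definition thompson_subgroup (gT : finGroupType) (p : nat) (S : {set gT}) : {set gT} :=
  <<\bigcup_(E in 'E_p^('r_p(S))(S)) E>>.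

Definition Omega1 (gT : finGroupType) (p : nat) (H : {set gT}) : {set gT} :=
  <<[set x in H | #[x] == p]>>.

Definition iter_comm (gT : finGroupType) (X Y : {set gT}) (k : nat) : {set gT} :=
  iter k (fun Z => [~: Z, Y]) X.

Definition has_Qseries (gT : finGroupType) (p : nat) (S K : {set gT}) : Prop :=
  exists (k : nat) (Q : nat -> {group gT}),
    [/\ Q 0 :=: 1, Q k :=: K,
        (forall i, (i <= k)%N -> Q i <| S),
        (forall i, (i < k)%N -> Q i \subset Q i.+1) &
        (forall i, (1 <= i <= k)%N ->
           iter_comm (Omega1 p 'C_S(Q i.-1)) (Q i) p.-1 :=: 1)].

Definition is_oliver_subgroup (gT : finGroupType) (p : nat) (S X : {set gT}) : Prop :=
  [/\ X <| S, has_Qseries p S X &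
      forall K : {group gT}, K <| S -> has_Qseries p S K -> K \subset X].

Definition prime_power (q : nat) : Prop :=
  exists r e : nat, prime r /\ (0 < e)%N /\ q = (r ^ e)%N.

(* Main.v *)
Require Import Defs.
From HB Require Import structures.
From mathcomp Require Import all_boot all_order all_algebra all_fingroup all_solvable all_field.
From mathcomp Require Import mxrepresentation mxabelem zify ring.
Set Implicit Arguments.
Unset Strict Implicit.
Unset Printing Implicit Defensive.
Import GRing.Theory.
Local Open Scope group_scope.

(** If [p] divides [q], then the Oliver subgroup is [S] itself.  Indeed [S]
    fixes an isotropic vector [v] (unless [S = 1]); the unipotent radical [R] of
    the stabilizer of [v] has class at most 2, is contained in [S] by maximality
    of [S], and its centralizer in [S] is central.  As [S, R; 3] = 1 and
    [p - 1 >= 4], the chain [1 <= R <= S] is a Q-series.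

    If [p] does not divide [q], then [J(S)] is abelian, and an abelian normal
    subgroup always lies in the Oliver subgroup.  Let [f] be the order of [q^2]
    modulo [p].  Over the field with [q^2] elements, a simple module of an
    elementary abelian [p]-group has dimension at most [f], so the hermitian
    space splits orthogonally into invariant pieces of dimension at most [2 f];
    hence an elementary abelian subgroup of maximal rank is generated by elements
    [x] such that [x - 1] has rank at most [2 f].  On the other hand, two
    non-commuting elements [x], [y] of a [p]-group generate a group whose derived
    subgroup contains a central element [z] of order [p].  The determinant of [z]
    on an eigenspace is 1, so [p] divides the dimension of the eigenspaces of [z]
    at its nontrivial eigenvalues, of which there are at least [f] by Galois
    conjugation; therefore the ranks of [x - 1] and [y - 1] add up to at least
    [p f], which exceeds [4 f]. *)

(** * The Oliver subgroup *)

Section Oliver.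
Variables (gT : finGroupType) (p : nat) (S : {group gT}).
Implicit Types A B K L : {group gT}.

Lemma iter_comm_eq1 (X Y : {set gT}) k m :
  k <= m -> iter_comm X Y k :=: 1 -> iter_comm X Y m :=: 1.
Proof.
move=> /subnK<- tr_k; elim: (m - k)%N => // j IHj.
by rewrite addSn /iter_comm iterS -/(iter_comm X Y _) IHj comm1G.
Qed.

Canonical Omega1_group (H : {set gT}) := [group of Omega1 p H].

Lemma group_set_iter_comm K (Y : {set gT}) k : group_set (iter_comm K Y k).
Proof. by case: k => [|k]; apply: groupP. Qed.

Canonical iter_comm_group K Y k := group (group_set_iter_comm K Y k).

(** One link of a Q-series; as a relation it makes Q-series paths from the trivial group, to be
    concatenated by transitivity of [connect]. *)
Definition qstep : rel {group gT} := fun A B =>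
  [&& A <| S, B <| S, A \subset B &
      iter_comm (Omega1 p 'C_S(A)) B p.-1 == 1].

Lemma has_QseriesP K :
  K <| S -> has_Qseries p S K <-> connect qstep 1%G K.
Proof.
move=> nKS; split=> [[k [Q [Q0 Qk nQ sQ cQ]]] | /connectP[s path_s def_K]].
  have conQ i : i <= k -> connect qstep 1%G (Q i).
    elim: i => [|i IHi] le_ik.
      by rewrite (_ : Q 0 = 1%G) ?connect0 //; apply/val_inj.
    apply: connect_trans (IHi (ltnW le_ik)) (connect1 _).
    by rewrite /qstep !nQ ?sQ ?(ltnW le_ik) //= (cQ i.+1) ?le_ik.
  by rewrite (_ : K = Q k) ?conQ //; apply/val_inj.
exists (size s), (nth 1%G (1%G :: s)).
have step i : i < size s ->
    qstep (nth 1%G (1%G :: s) i) (nth 1%G (1%G :: s) i.+1).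
  by move: i; apply/pathP.
split=> //= [|i le_is|i /step/and4P[] //|[|i] // lt_is].
- by rewrite def_K -[size s]/(size (1%G :: s)).-1 nth_last.
- case: i le_is => [|i] lt_is; first by rewrite normal1.
  by have /and4P[] := step i lt_is.
by have /and4P[_ _ _ /eqP] := step i lt_is.
Qed.

(** The group [W] centralizes [K], so [[z, x * y] = [z, y]] for [z] in [W], [x] in [K] and [y] in
    [B]. Hence the iterated commutator lies in the one that vanishes for [A] and [B]. *)
Lemma qstep_joing K A B : K <| S -> qstep A B -> qstep (K <*> A)%G (K <*> B)%G.
Proof.
move=> nKS /and4P[nAS nBS sAB /eqP cAB].
have [sKS nKS'] := andP nKS; have [sBS nBS'] := andP nBS.
apply/and4P; split; rewrite ?normalY ?genS ?setUS //.
set W := Omega1 _ _; have sWC: W \subset 'C(K).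
  rewrite gen_subG; apply/subsetP=> x; rewrite !inE => /andP[/andP[_ cx] _].
  by apply: subsetP cx; rewrite centS ?joing_subl.
have nWS: S \subset 'N(W).
  apply: norms_gen; apply/subsetP=> x Sx; rewrite inE.
  apply/subsetP=> _ /imsetP[y /setIdP[Cy oy] ->].
  rewrite inE orderJ oy andbT memJ_norm //.
  by apply: (subsetP (normsI (normG _) (norms_cent _))) Sx; rewrite normsY ?normal_norm.
have nWKB: K <*> B \subset 'N(W).
  by apply: subset_trans nWS; rewrite join_subG sKS.
(* Intersecting with [W] records in the induction that every iterated commutator still centralizes
   [K]. *)
suff sub k : iter_comm W (K <*> B) k \subset
    iter_comm (Omega1 p 'C_S(A)) B k :&: W.
  rewrite -subG1 -cAB (subset_trans (sub _)) ?subsetIl //.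
elim: k => [|k /subsetIP[IHk sZW]].
  rewrite /iter_comm /= subsetIidr genS //; apply/subsetP=> x; rewrite !inE.
  by case/andP=> /andP[-> cx] ->; rewrite (subsetP (centS (joing_subr K A))).
rewrite /= -!/(iter_comm _ _ k) subsetI; apply/andP; split; last first.
  by apply: subset_trans (commSg _ sZW) _; rewrite commg_subl.
set Z := iter_comm W _ k in IHk sZW *.
rewrite norm_joinEr ?(subset_trans sBS) // gen_subG.
apply/subsetP=> _ /imset2P[z _ Zz /mulsgP[x y Kx By ->] ->].
rewrite commgMJ; have /commgP/eqP-> : commute z x.
  exact: (centP (subsetP sWC z (subsetP sZW z Zz)) x Kx).
by rewrite conj1g mulg1 mem_commg // (subsetP IHk).
Qed.

(** Run the series of [K], then that of [L] with each term joined to [K]. *)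
Lemma connect_qstep_joing K L :
  K <| S -> connect qstep 1%G K -> connect qstep 1%G L ->
  connect qstep 1%G (K <*> L)%G.
Proof.
move=> nKS conK /connectP[s path_s ->]; apply: connect_trans conK _.
have {1}-> : K = (K <*> 1%G)%G by apply/val_inj; rewrite /= joingG1.
elim: s 1%G path_s => //= A s IHs B /andP[sBA /IHs].
by apply: connect_trans; rewrite connect1 ?qstep_joing.
Qed.

Lemma connect_qstep_normal K : connect qstep 1%G K -> K <| S.
Proof.
case/connectP=> s; elim/last_ind: s => [|s A _] /=.
  by move=> _ ->; exact: normal1.
by rewrite rcons_path last_rcons => /andP[_ /and4P[_ nAS _ _]] ->.
Qed.

(** A reachable subgroup of largest order absorbs every other one, since their join is reachable
    too. *)
Lemma oliver_subgroup_exists : exists X : {group gT}, is_oliver_subgroup p S X.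
Proof.
case: (arg_maxnP (fun X : {group gT} => #|X|) (connect0 qstep 1%G)) => X conX maxX.
have nXS := connect_qstep_normal conX.
exists X; split=> // [|K nKS QK]; first exact/has_QseriesP.
have conK : connect qstep 1%G K by apply/has_QseriesP.
have := maxX _ (connect_qstep_joing nKS conK conX) => /= leX.
have /eqP-> : X :==: K <*> X by rewrite eqEcard joing_subr.
exact: joing_subl.
Qed.

(** The chain [1 <= K] suffices: [[S, K]] lies in [K] by normality and [[K, K] = 1], so two
    commutators vanish, and [p - 1 >= 2]. *)
Lemma abelian_has_Qseries K :
  2 < p -> K <| S -> abelian K -> has_Qseries p S K.
Proof.
move=> p_gt2 nKS abK; apply/has_QseriesP => //; apply: connect1.
rewrite /qstep nKS normal1 sub1G /=; apply/eqP.
apply: (@iter_comm_eq1 _ _ 2); first by rewrite -ltnS prednK // ltnW // ltnW.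
apply/eqP; rewrite -subG1 /iter_comm /=.
apply: (@subset_trans _ _ [~: K, K]); last by rewrite subG1; apply/eqP/commG1P.
rewrite commSg // commg_subr (subset_trans _ (normal_norm nKS)) //.
rewrite gen_subG; apply/subsetP=> x; rewrite !inE.
by case/andP=> /andP[].
Qed.

(** The chain is [1 <= K <= S]. The first link needs three commutators, one to enter [K] and two for
    its class; the second needs one, as the centralizer of [K] is central. *)
Lemma Qseries_full K : 4 < p -> K <| S -> 'C_S(K) \subset 'C(S) ->
  [~: [~: K, K], K] = 1 -> has_Qseries p S S.
Proof.
move=> p_gt4 nKS sCC clK; apply/has_QseriesP => //.
have [sKS nKS'] := andP nKS.
have sO (H : {set gT}) : Omega1 p H \subset <<H>>.
  by rewrite genS //; apply/subsetP=> x /setIdP[].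
have p1 : 3 <= p.-1 by rewrite -ltnS prednK ?(ltn_trans _ p_gt4) // ltnW.
apply: (@connect_trans _ _ K); apply: connect1; rewrite /qstep nKS ?normal_refl.
  rewrite normal1 sub1G /=; apply/eqP; apply: (@iter_comm_eq1 _ _ 3) => //.
  apply/eqP; rewrite -subG1 /iter_comm /= -clK !commSg //.
  rewrite commg_subr (subset_trans (sO _)) // genGid.
  by rewrite (subset_trans (subsetIl _ _)).
rewrite sKS /=; apply/eqP; apply: (@iter_comm_eq1 _ _ 1); first exact: ltnW (ltnW _).
by apply/commG1P; rewrite (subset_trans (sO _)) // genGid.
Qed.

End Oliver.

(** * Hermitian forms and unitary groups *)

Section Adjoint.
Local Open Scope ring_scope.
Variables (F : fieldType) (sigma : {rmorphism F -> F}).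
Hypothesis sigmaK : involutive sigma.

Definition adjmx m n (A : 'M[F]_(m, n)) : 'M_(n, m) := (map_mx sigma A)^T.

Lemma adjmxK m n (A : 'M_(m, n)) : adjmx (adjmx A) = A.
Proof. by apply/matrixP=> i j; rewrite !mxE sigmaK. Qed.

Lemma adjmxM m n r (A : 'M_(m, n)) (B : 'M_(n, r)) :
  adjmx (A *m B) = adjmx B *m adjmx A.
Proof. by rewrite /adjmx map_mxM trmx_mul. Qed.

Lemma adjmxD m n (A B : 'M_(m, n)) : adjmx (A + B) = adjmx A + adjmx B.
Proof. by rewrite /adjmx map_mxD linearD. Qed.

Lemma adjmxB m n (A B : 'M_(m, n)) : adjmx (A - B) = adjmx A - adjmx B.
Proof. by rewrite /adjmx map_mxB linearB. Qed.

Lemma adjmx1 n : adjmx 1%:M = 1%:M :> 'M_n.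
Proof. by rewrite /adjmx map_mx1 trmx1. Qed.

Lemma adjmx0 m n : adjmx (0 : 'M_(m, n)) = 0.
Proof. by rewrite /adjmx map_mx0 trmx0. Qed.

Lemma mxrank_adjmx m n (A : 'M_(m, n)) : \rank (adjmx A) = \rank A.
Proof. by rewrite /adjmx mxrank_tr mxrank_map. Qed.

Definition herm n (u w : 'rV[F]_n) : F := (u *m adjmx w) 0 0.

Lemma mulmx_adj_herm n (u w : 'rV_n) : u *m adjmx w = (herm u w)%:M.
Proof. by rewrite /herm -mx11_scalar. Qed.

Lemma hermDl n (u v w : 'rV_n) : herm (u + v) w = herm u w + herm v w.
Proof. by rewrite /herm mulmxDl mxE. Qed.

Lemma hermNl n (u w : 'rV_n) : herm (- u) w = - herm u w.
Proof. by rewrite /herm mulNmx mxE. Qed.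

Lemma hermZl n a (u w : 'rV_n) : herm (a *: u) w = a * herm u w.
Proof. by rewrite /herm -scalemxAl mxE. Qed.

Lemma herm_sym n (u w : 'rV_n) : sigma (herm u w) = herm w u.
Proof.
by rewrite /herm -[u *m _]adjmxK adjmxM adjmxK /adjmx !mxE sigmaK.
Qed.

Lemma hermDr n (u v w : 'rV_n) : herm u (v + w) = herm u v + herm u w.
Proof. by rewrite -herm_sym hermDl rmorphD !herm_sym. Qed.

Lemma hermZr n a (u w : 'rV_n) : herm u (a *: w) = sigma a * herm u w.
Proof. by rewrite -herm_sym hermZl rmorphM herm_sym. Qed.

Lemma herm0l n (u : 'rV_n) : herm 0 u = 0.
Proof. by rewrite /herm mul0mx mxE. Qed.

Lemma hermNr n (u w : 'rV_n) : herm u (- w) = - herm u w.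
Proof. by rewrite -scaleN1r hermZr rmorphN1 mulN1r. Qed.

Lemma herm_delta n (u : 'rV_n) i : herm u (delta_mx 0 i) = u 0 i.
Proof.
rewrite /herm mxE (bigD1 i) //= big1 => [|j ne_ji].
  by rewrite !mxE !eqxx rmorph1 mulr1 addr0.
by rewrite !mxE (negPf ne_ji) andbF rmorph0 mulr0.
Qed.

Lemma herm_nondeg n (u : 'rV_n) : (forall w, herm u w = 0) -> u = 0.
Proof. by move=> u0; apply/rowP=> i; rewrite -herm_delta u0 mxE. Qed.

Lemma herm_perp n (u v : 'rV_n) :
  (forall w, herm w v = 0 -> herm u w = 0) -> exists a, u = a *: v.
Proof.
move=> perp_u; have [v0|nz_v] := eqVneq v 0.
  exists 0; rewrite scale0r; apply: herm_nondeg => w; apply: perp_u.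
  by rewrite v0 -herm_sym herm0l rmorph0.
have [x vx] : exists x, herm x v != 0.
  have /rV0Pn[i vi] := nz_v; exists (delta_mx 0 i).
  by rewrite -herm_sym herm_delta fmorph_eq0.
exists (herm u x / herm v x); apply/eqP; rewrite -subr_eq0; apply/eqP.
apply: herm_nondeg => w; pose w' := w - (herm w v / herm x v) *: x.
have /perp_u : herm w' v = 0 by rewrite hermDl hermNl hermZl divfK ?subrr.
have nz_vx : herm v x != 0 by rewrite -herm_sym fmorph_eq0.
rewrite /w' hermDr hermNr hermZr fmorph_div /= !herm_sym hermDl hermNl hermZl.
by move=> <-; ring.
Qed.

End Adjoint.

(** * Unitary matrices as isometries of row vectors *)

Section UnitarySet.
Variables (F : finFieldType) (sigma : {rmorphism F -> F}) (n : nat).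
Local Notation adj := (adjmx sigma).
Local Notation h := (herm sigma).

(** Stated for any endomorphism [sigma]; for the Frobenius map it is convertible to
    [unitary_group]. *)
Definition usubset : {set {'GL_n[F]}} :=
  [set u : {'GL_n[F]} | adj (GLval u) *m GLval u == 1%:M]%R.

Lemma unitaryP (u : {'GL_n[F]}) :
  reflect (GLval u *m adj (GLval u) = 1%:M)%R (u \in usubset).
Proof. by rewrite inE; apply: (iffP eqP) => /mulmx1C. Qed.

Lemma unitary_herm u x y : u \in usubset -> h (x *m GLval u) (y *m GLval u) = h x y.
Proof.
move=> /unitaryP Uu.
by rewrite /herm adjmxM mulmxA -(mulmxA x) Uu mulmx1.
Qed.

Lemma unitary_lift (A : 'M[F]_n.-1.+1) :
  (A *m adj A = 1%:M)%R -> exists2 u, u \in usubset & GLval u = A.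
Proof.
move=> AA; have uA : A \is a GRing.unit by case: (mulmx1_unit AA).
by exists (Sub A uA); [apply/unitaryP; rewrite SubK | rewrite -[GLval]/val SubK].
Qed.

Lemma herm_unitary (A : 'M[F]_n.-1.+1) :
  (forall x y, h (x *m A) (y *m A) = h x y)%R ->
  exists2 u, u \in usubset & GLval u = A.
Proof.
move=> hA; apply: unitary_lift.
apply/row_matrixP=> i; rewrite !row_mul row1; apply/rowP=> j.
rewrite -(herm_delta sigma) -[RHS](herm_delta sigma) -[RHS]hA rowE.
by rewrite /herm adjmxM !mulmxA.
Qed.

Lemma usubset_group_set : group_set usubset.
Proof.
apply/group_setP; split=> [|x y /unitaryP Ux /unitaryP Uy].
  by rewrite inE GL_1E adjmx1 mulmx1.
apply/unitaryP; rewrite GL_MxE adjmxM mulmxA -(mulmxA (GLval x)) Uy.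
by rewrite mulmx1.
Qed.
Canonical unitary_sub := group usubset_group_set.

Lemma GL_X (u : {'GL_n[F]}) k : GLval (u ^+ k) = (GLval u ^+ k)%R.
Proof. by elim: k => // k IHk; rewrite expgS exprS GL_ME IHk. Qed.

Lemma GL_mulKV (u : {'GL_n[F]}) m (A : 'M[F]_(m, _)) :
  (A *m GLval u^-1 *m GLval u = A)%R.
Proof. by rewrite -mulmxA -GL_MxE mulVg GL_1E mulmx1. Qed.

End UnitarySet.

Section NaturalRepresentation.
Variables (F : finFieldType) (n : nat).

Lemma GL_eqP (g g' : {'GL_n[F]}) :
  (forall y : 'rV_n.-1.+1, y *m GLval g = y *m GLval g')%R -> g = g'.
Proof. by move=> eq_g; apply/val_inj/row_matrixP=> i; rewrite !rowE eq_g. Qed.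

Lemma GL_mx_repr (S : {group {'GL_n[F]}}) :
  mx_repr S (fun g : {'GL_n[F]} => GLval g).
Proof. by split=> // x y _ _; rewrite GL_MxE. Qed.

Definition GL_repr S := MxRepresentation (GL_mx_repr S).

End NaturalRepresentation.

(** * Defining characteristic *)

Section DefiningCharacteristic.
Variables (F : finFieldType) (sigma : {rmorphism F -> F}) (n p : nat).
Hypothesis sigmaK : involutive sigma.
Hypothesis sigma_neq1 : exists t, sigma t != t.
Hypothesis norm_onto : forall a : F, sigma a = a ->
  exists t, (t * sigma t)%R = a.
Hypothesis pF : p \in [pchar F]%R.
Hypothesis p_gt2 : 2 < p.

Local Notation h := (herm sigma).
Local Notation U := (usubset sigma n).
Local Notation UG := (unitary_sub sigma n).
Implicit Types (x y w : 'rV[F]_n.-1.+1) (g : {'GL_n[F]}).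

(** * The stabilizer of an isotropic vector and its unipotent radical *)

Section IsotropicVector.
Variable v : 'rV[F]_n.-1.+1.
Hypotheses (nz_v : v != 0%R) (iso_v : h v v = 0%R).

Definition vstab : {set {'GL_n[F]}} := [set g in U | v *m GLval g == v]%R.

(* The unipotent radical of the stabilizer of the isotropic line spanned by v. *)
Definition vrad : {set {'GL_n[F]}} :=
  [set g in vstab | [forall w : 'rV_n.-1.+1,
     (h w v == 0) ==> (w *m GLval g - w <= v)%MS]]%R.

Lemma vstabP g : reflect (g \in U /\ v *m GLval g = v)%R (g \in vstab).
Proof. by apply: (iffP setIdP) => [][Ug /eqP]. Qed.

Lemma vradP g :
  reflect (g \in vstab /\
           forall w, h w v = 0 -> exists a, w *m GLval g = w + a *: v)%R
          (g \in vrad).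
Proof.
apply: (iffP setIdP) => [][-> Rg]; split=> //.
  move=> w wv; have /forallP/(_ w) := Rg; rewrite wv eqxx => /sub_rVP[a def_a].
  by exists a; rewrite -def_a addrC subrK.
apply/forallP=> w; apply/implyP=> /eqP/Rg[a ->].
by rewrite addrC addKr scalemx_sub.
Qed.

Lemma vstab_group_set : group_set vstab.
Proof.
apply/group_setP; split=> [|x y /vstabP[Ux vx] /vstabP[Uy vy]]; apply/vstabP.
  by rewrite GL_1E mulmx1; split=> //; apply: (group1 UG).
by rewrite GL_MxE mulmxA vx vy; split=> //; apply: (groupM (G := UG)).
Qed.
Canonical vstab_group := group vstab_group_set.

Lemma vstab_perp g w : g \in vstab -> h (w *m GLval g)%R v = h w v.
Proof. by move=> /vstabP[Ug vg]; rewrite -[in LHS]vg unitary_herm. Qed.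

Lemma vrad_group_set : group_set vrad.
Proof.
apply/group_setP; split=> [|a b /vradP[Ha Ra] /vradP[Hb Rb]]; apply/vradP.
  by split=> [|w _]; [exact: group1 | exists 0%R; rewrite GL_1E mulmx1 scale0r addr0].
split=> [|w wv]; first exact: groupM.
have [_ vb] := vstabP _ Hb.
have [c wa] := Ra w wv; have [d wb] := Rb w wv.
exists (d + c)%R.
by rewrite GL_MxE mulmxA wa mulmxDl wb -scalemxAl vb scalerDl addrA.
Qed.
Canonical vrad_group := group vrad_group_set.

Lemma vrad_normal : vrad <| vstab.
Proof.
apply/andP; split; first by apply/subsetP=> g /vradP[].
apply/subsetP=> x Hx; rewrite inE; apply/subsetP=> _ /imsetP[g /vradP[Hg Rg] ->].
apply/vradP; split=> [|w wv]; first exact: groupJ.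
have Hx' := groupVr Hx; have [_ vx] := vstabP _ Hx.
have [a wg] : exists a, (w *m GLval x^-1 *m GLval g = w *m GLval x^-1 + a *: v)%R.
  by apply: Rg; rewrite vstab_perp.
exists a; rewrite conjgE !GL_MxE !mulmxA wg mulmxDl GL_mulKV.
by rewrite -scalemxAl vx.
Qed.

(** The element [g] moves every [y] by some [a *: v], while [y x - y] is orthogonal to [v] and so
    fixed by [g]. Both products therefore send [y] to [y x + a *: v]. *)
Lemma perp_fix_central g (x : {'GL_n[F]}) : g \in U ->
  (forall w, h w v = 0%R -> w *m GLval g = w)%R -> x \in vstab -> commute g x.
Proof.
move=> Ug fix_g Hx; apply: GL_eqP => y; rewrite !GL_MxE !mulmxA.
have [a yg] : exists a, (y *m GLval g - y = a *: v)%R.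
  apply: (herm_perp sigmaK) => w wv.
  by rewrite hermDl hermNl -{1}(fix_g w wv) unitary_herm ?subrr.
have /fix_g : h (y *m GLval x - y)%R v = 0%R.
  by rewrite hermDl hermNl vstab_perp ?subrr.
rewrite mulmxBl => /(canRL (subrK _)) ->.
have [_ vx] := vstabP _ Hx.
rewrite (canRL (subrK _) yg) mulmxDl -scalemxAl vx.
by rewrite addrCA subrK.
Qed.

(** On the orthogonal of [v] the radical acts by adding multiples of [v], and such maps commute.
    Commutators thus fix this orthogonal pointwise, and [perp_fix_central] applies. *)
Lemma vrad_class2 : [~: [~: vrad, vrad], vrad] = 1.
Proof.
apply/commG1P; rewrite gen_subG; apply/subsetP=> _ /imset2P[a b Ra Rb ->].
apply/centP=> x Rx; have Hx := subsetP (normal_sub vrad_normal) x Rx.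
have /vstabP[Uab _] : [~ a, b] \in vstab.
  by apply: (subsetP (normal_sub vrad_normal)); apply: groupR.
apply: perp_fix_central => // w wv.
have [Ha _] := vradP _ Ra; have [Hb _] := vradP _ Rb.
have comm_ab u : h u v = 0%R ->
    (u *m GLval a *m GLval b = u *m GLval b *m GLval a)%R.
  move=> uv; have [_ /(_ u uv)[c ua]] := vradP _ Ra.
  have [_ /(_ u uv)[d ub]] := vradP _ Rb.
  have [_ va] := vstabP _ Ha; have [_ vb] := vstabP _ Hb.
  by rewrite ua ub !mulmxDl ua ub -!scalemxAl va vb addrAC.
rewrite commgEl conjgE !GL_MxE !mulmxA comm_ab ?GL_mulKV //.
by rewrite !vstab_perp ?groupV.
Qed.

Local Open Scope ring_scope.

Lemma two_neq0 : (2%:R != 0 :> F)%R.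
Proof. by rewrite -(dvdn_pcharf pF) gtnNdvd. Qed.

(** These are the Siegel (Eichler) transformations. *)
Lemma transvection_vrad w : h w v = 0%R ->
  (* The scalar [c] will have trace [- h w w], which makes the map an isometry; [- h w w / 2] works,
     being fixed by [sigma]. *)
  exists2 t, t \in vrad & exists c, forall y,
    (y *m GLval t = y + h y v *: w - h y w *: v + (c * h y v) *: v)%R.
Proof.
move=> wv; have [c trc] : exists c, sigma c + c = - h w w.
  exists (- (h w w / 2%:R)); rewrite rmorphN /= fmorph_div /= rmorph_nat (herm_sym sigmaK).
  by field; exact: two_neq0.
pose T := 1%:M + adjmx sigma v *m w - adjmx sigma w *m v
          + c *: (adjmx sigma v *m v).
have defT y : y *m T = y + h y v *: w - h y w *: v + (c * h y v) *: v.
  rewrite /T !mulmxDr mulmxN -scalemxAr !mulmxA mulmx1 !mulmx_adj_herm.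
  by rewrite !mul_scalar_mx scalerA.
have vw : h v w = 0 by rewrite -(herm_sym sigmaK) wv rmorph0.
have [|t Ut def_t] := @herm_unitary _ sigma n T.
  move=> x y; rewrite !defT.
  rewrite !(hermDl, hermDr sigmaK, hermNl, hermNr sigmaK, hermZl, hermZr sigmaK).
  rewrite iso_v vw wv !(rmorphM, rmorphN) /=.
  rewrite -(herm_sym sigmaK y w) -(herm_sym sigmaK y v).
  have -> : h w w = - (sigma c + c) by rewrite trc opprK.
  by ring.
have vt : v *m GLval t = v.
  by rewrite def_t defT iso_v vw mulr0 !scale0r !addr0 subr0.
exists t; last by exists c => y; rewrite def_t.
apply/vradP; split=> [|u uv]; first exact/vstabP.
exists (- h u w); rewrite def_t defT uv mulr0 !scale0r !addr0.
by rewrite scaleNr.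
Qed.

(** Commuting with the Siegel transformation of [w] forces [w g = w + a *: v] with [a] fixed by
    [sigma]. Applied to [t *: w] with [sigma t != t], the same shows that [t * a] is fixed, so
    [a = 0]. *)
Lemma cent_vrad g w : g \in vstab -> g \in 'C(vrad) -> h w v = 0%R ->
  (w *m GLval g = w)%R.
Proof.
move=> Hg Cg; have [Ug vg] := vstabP _ Hg.
have [y0 y0v] : exists y, h y v != 0.
  have /rV0Pn[i vi] := nz_v; exists (delta_mx 0 i).
  by rewrite -(herm_sym sigmaK) herm_delta fmorph_eq0.
have key u : h u v = 0 -> exists2 a, sigma a = a & u *m GLval g = u + a *: v.
  move=> uv; have [t Rt [c def_t]] := transvection_vrad uv.
  pose d := u *m GLval g - u.
  (* Compare [t * g] and [g * t] on the preimage of [y] under [g]; the terms in [c] cancel. *)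
  have eq_d y : h y v *: d = h y d *: v.
    have : y *m GLval g^-1 *m GLval (t * g) = y *m GLval g^-1 *m GLval (g * t).
      by rewrite (centP Cg t Rt).
    rewrite !GL_MxE !mulmxA GL_mulKV !def_t !mulmxDl mulNmx -!scalemxAl vg GL_mulKV.
    rewrite vstab_perp ?groupV // => /(addIr _).
    have -> : h (y *m GLval g^-1) u = h y (u *m GLval g).
      by rewrite -[in RHS](GL_mulKV g y) unitary_herm.
    rewrite -!addrA => /addrI eq_y.
    rewrite /d (hermDr sigmaK) (hermNr sigmaK) scalerBr scalerBl.
    by rewrite (canRL (subrK _) eq_y) addrAC [X in X + _]addrAC subrr add0r addrC.
  have [a def_d] : exists a, d = a *: v.
    exists (h y0 d / h y0 v); rewrite mulrC -scalerA -eq_d scalerA.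
    by rewrite mulVf ?scale1r.
  exists a; last by rewrite -def_d addrC subrK.
  have := eq_d y0; rewrite def_d (hermZr sigmaK) scalerA => /eqP.
  rewrite -subr_eq0 -scalerBl scaler_eq0 (negPf nz_v) orbF mulrC -mulrBl.
  by rewrite mulf_eq0 (negPf y0v) orbF subr_eq0 => /eqP.
move=> wv; have [a sa wg] := key w wv; have [t st] := sigma_neq1.
have [b sb] : exists2 b, sigma b = b & (t *: w) *m GLval g = t *: w + b *: v.
  by apply: key; rewrite hermZl wv mulr0.
rewrite -scalemxAl wg scalerDr => /addrI; rewrite scalerA => /eqP.
rewrite -subr_eq0 -scalerBl scaler_eq0 (negPf nz_v) orbF subr_eq0 => /eqP tab.
have /eqP := sb; rewrite -tab rmorphM /= sa -subr_eq0 -mulrBl mulf_eq0.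
by rewrite subr_eq0 (negPf st) /= => /eqP->; rewrite scale0r addr0.
Qed.

(** In characteristic [p], [g ^ p - 1 = (g - 1) ^ p], which vanishes because [(g - 1) ^ 3 = 0] and
    [p >= 3]. *)
Lemma vrad_pgroup : p.-group vrad.
Proof.
have p_pr := pcharf_prime pF.
rewrite -pnat_exponent; apply: (@pnat_dvd _ p); last exact: pnat_id.
apply/exponentP=> g /vradP[Hg Rg]; have [Ug vg] := vstabP _ Hg.
have pM : p \in [pchar 'M[F]_n.-1.+1] by rewrite pchar_lalg.
(* The map [g - 1] sends the space into the orthogonal of [v], that into the line of [v], and [v] to
   0. *)
have nil3 : (GLval g - 1) ^+ 3 = 0.
  apply/row_matrixP=> i; rewrite rowE row0 !exprS expr0 mulr1 -!mulmxE !mulmxA.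
  set y := delta_mx _ _.
  have yv : h (y *m (GLval g - 1)) v = 0.
    by rewrite mulmxBr mulmx1 hermDl hermNl vstab_perp ?subrr.
  have [a ->] : exists a, y *m (GLval g - 1) *m (GLval g - 1) = a *: v.
    have [a def_a] := Rg _ yv; exists a.
    by rewrite [in LHS]mulmxBr mulmx1 def_a addrC addKr.
  by rewrite mulmxBr mulmx1 -scalemxAl vg subrr.
apply/val_inj; change (GLval (g ^+ p)%g = 1).
rewrite GL_X; apply/eqP; rewrite -subr_eq0 -[1 in X in X == _](expr1n _ p).
rewrite -!(pFrobenius_autE pM) -pFrobenius_autB_comm; last exact: commr1.
by rewrite pFrobenius_autE -(subnK p_gt2) exprD nil3 mulr0.
Qed.

(** Being Sylow in the stabilizer, [S] contains its normal [p]-subgroup [vrad]. What centralizes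
    [vrad] fixes the orthogonal of [v] pointwise, hence is central. *)
Lemma isotropic_fix_Qseries (S : {group {'GL_n[F]}}) :
  (4 < p)%N -> p.-Sylow(U) S -> (forall g, g \in S -> v *m GLval g = v)%R ->
  has_Qseries p S S.
Proof.
move=> p_gt4 sylS fixS; have sSU := pHall_sub sylS.
have sSH : S \subset vstab.
  by apply/subsetP=> g Sg; apply/vstabP; split; [apply: (subsetP sSU) | apply: fixS].
have sHU : vstab \subset UG by apply/subsetP=> g /vstabP[].
have sylSH : p.-Sylow(vstab) S := pHall_subl sSH sHU sylS.
have sRS : vrad \subset S.
  exact: normal_sub_max_pgroup (Hall_max sylSH) vrad_pgroup vrad_normal.
apply: (@Qseries_full _ _ _ vrad_group) => //; last exact: vrad_class2.
  exact: normalS sRS sSH vrad_normal.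
apply/subsetP=> g /setIP[Sg Cg]; apply/centP=> x Sx.
have Hg := subsetP sSH g Sg; have Hx := subsetP sSH x Sx.
by apply: perp_fix_central => //; [case/vstabP: Hg | move=> w; apply: cent_vrad].
Qed.

End IsotropicVector.

(** * Isotropic vectors fixed by a [p]-group in characteristic [p] *)

Local Open Scope ring_scope.

(** A [p]-group fixes some [v0], and some [v1] orthogonal to it if [v0] is anisotropic. If [v1] is
    anisotropic too, a combination of both is isotropic because norms are onto. *)
Lemma pgroup_isotropic_fix (S : {group {'GL_n[F]}}) :
  p.-group S -> S \subset U -> S :!=: 1%g ->
  exists v, [/\ v != 0, h v v = 0 &
    forall g, g \in S -> v *m GLval g = v]%R.
Proof.
move=> pS sSU ntS; pose rS := GL_repr S.
have [v0 nz_v0 fix_v0] : exists2 v0 : 'rV_n.-1.+1, v0 != 0 &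
    forall g, g \in S -> v0 *m GLval g = v0.
  have := rfix_pgroup_pchar pF rS (ltn0Sn _) pS (subxx _).
  case/rowV0Pn=> v0 fix0 nz0; exists v0 => // g Sg.
  exact: (rfix_mxP _ fix0 g Sg).
have [hv0|nz_hv0] := eqVneq (h v0 v0) 0; first by exists v0.
pose W := kermx (adjmx sigma v0).
have modW : mxmodule rS W.
  apply/mxmoduleP=> g Sg; apply/sub_kermxP.
  have /unitaryP Ug := subsetP sSU g Sg.
  rewrite -mulmxA -[in X in _ *m (_ *m X)](fix_v0 g Sg) adjmxM.
  by rewrite (mulmxA (GLval g)) Ug mul1mx mulmx_ker.
(* If [W = 0], then [v0] spans the space and [S] is trivial. *)
have [W0|nzW] := eqVneq W 0.
  case/eqP: ntS; apply/trivgP/subsetP=> g Sg; rewrite inE; apply/eqP/GL_eqP=> y.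
  have : (y - (h y v0 / h v0 v0) *: v0 <= W)%MS.
    apply/sub_kermxP; rewrite mulmx_adj_herm hermDl hermNl hermZl divfK //.
    by rewrite subrr raddf0.
  rewrite W0 submx0 subr_eq0 => /eqP->.
  by rewrite -!scalemxAl fix_v0 // GL_1E mulmx1.
have [v1 [nz_v1 hv1 fix_v1]] : exists v1 : 'rV_n.-1.+1,
    [/\ v1 != 0, h v1 v0 = 0 & forall g, g \in S -> v1 *m GLval g = v1].
  have rk_gt0 : (0 < \rank W)%N by rewrite lt0n mxrank_eq0.
  have := rfix_pgroup_pchar pF (submod_repr modW) rk_gt0 pS (subxx _).
  rewrite -mxrank_eq0 (rfix_submod modW) // mxrank_in_submod ?capmxSl //.
  rewrite mxrank_eq0 => /rowV0Pn[v1]; rewrite sub_capmx => /andP[W_v1 fix1] nz1.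
  exists v1; split=> // [|g Sg]; last exact: (rfix_mxP _ fix1 g Sg).
  by rewrite /herm (sub_kermxP W_v1) mxE.
have [hv1'|nz_hv1] := eqVneq (h v1 v1) 0; first by exists v1.
have [t tt] : exists t, t * sigma t = - (h v0 v0 / h v1 v1).
  by apply: norm_onto; rewrite rmorphN /= fmorph_div /= !(herm_sym sigmaK).
have h01 : h v0 v1 = 0 by rewrite -(herm_sym sigmaK) hv1 rmorph0.
exists (v0 + t *: v1); split=> [||g Sg].
- apply: contraNneq nz_hv0 => v00.
  have : h (v0 + t *: v1) v0 = 0 by rewrite v00 herm0l.
  by rewrite hermDl hermZl hv1 mulr0 addr0 => ->.
- rewrite !(hermDl, hermDr sigmaK, hermZl, hermZr sigmaK) hv1 h01 !mulr0.
  by rewrite addr0 add0r mulrA tt mulNr divfK ?subrr.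
by rewrite mulmxDl -scalemxAl fix_v0 // fix_v1.
Qed.

Lemma sylow_defining_Qseries (S : {group {'GL_n[F]}}) :
  (4 < p)%N -> p.-Sylow(U) S -> has_Qseries p S S.
Proof.
move=> p_gt4 sylS; have [S1|ntS] := eqVneq (S : {set _}) 1%g.
  by apply: abelian_has_Qseries; rewrite // ?S1 ?abelian1.
have [v [nz_v iso_v fix_v]] :=
  pgroup_isotropic_fix (pHall_pgroup sylS) (pHall_sub sylS) ntS.
exact: isotropic_fix_Qseries iso_v _ p_gt4 sylS fix_v.
Qed.

End DefiningCharacteristic.

(** * Cross characteristic: roots of unity *)

Section Frobenius.
Local Open Scope ring_scope.
Variables (R : comNzRingType) (q : nat).
Hypothesis qR : [pchar R].-nat q.

(** The proof argument is there so that the ring morphism structure can be attached to the map. *)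
Definition frob of [pchar R].-nat q := fun x : R => x ^+ q.

Lemma frob_nmod_morphism : nmod_morphism (frob qR).
Proof.
split=> [|x y]; rewrite /frob ?exprDn_pchar // expr0n.
by case: (q) qR.
Qed.

Lemma frob_monoid_morphism : monoid_morphism (frob qR).
Proof. by split=> [|x y]; rewrite /frob ?expr1n ?exprMn. Qed.

HB.instance Definition _ :=
  GRing.isNmodMorphism.Build R R (frob qR) frob_nmod_morphism.
HB.instance Definition _ :=
  GRing.isMonoidMorphism.Build R R (frob qR) frob_monoid_morphism.

End Frobenius.

Section CrossCharacteristic.
Local Open Scope ring_scope.

(** The polynomial [X^p - 1] is separable, so it has [p] distinct roots. *)
Lemma prim_root_exists (K : closedFieldType) p :
  p%:R != 0 :> K -> exists z : K, p.-primitive_root z.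
Proof.
move=> nz_p; have p_gt0 : (0 < p)%N by case: (p) nz_p; rewrite ?eqxx.
have [r def_r] := closed_field_poly_normal ('X^p - 1 : {poly K}).
have lead1 : lead_coef ('X^p - 1 : {poly K}) = 1.
  exact/eqP/(monicXnsubC 1 p_gt0).
rewrite lead1 scale1r in def_r.
have sep := separable_Xn_sub_1 nz_p; rewrite def_r in sep.
have size_r : size r = p.
  by apply: succn_inj; rewrite -(size_prod_XsubC r id) -def_r size_XnsubC.
have : has p.-primitive_root r.
  apply: has_prim_root; rewrite ?size_r //; last by rewrite -separable_prod_XsubC.
  apply/allP=> x r_x; rewrite unity_rootE; have : root (\prod_(z <- r) ('X - z%:P)) x.
    by rewrite root_prod_XsubC.
  by rewrite -def_r /root !hornerE subr_eq0.
by case/hasP=> z _; exists z.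
Qed.

Variables (F : finFieldType) (p : nat).
Hypothesis p_pr : prime p.
Hypothesis FF : [pchar F].-nat #|F|.
Hypothesis p'F : p \notin [pchar F].

Local Notation Q := #|F|%N.

Lemma coprime_card_field : coprime Q p.
Proof.
rewrite coprime_sym prime_coprime //; apply: contra p'F => dvd_p.
by rewrite (pnatPpi FF) // mem_primes p_pr dvd_p (ltnW (finNzRing_gt1 F)).
Qed.

Lemma fdeg_proof : exists k, (0 < k)%N && (Q ^ k == 1 %[mod p])%N.
Proof.
exists (totient p); rewrite totient_gt0 prime_gt0 //=.
by rewrite Euler_exp_totient ?coprime_card_field.
Qed.

(** The order of [#|F|] modulo [p], which is the degree over [F] of a primitive [p]-th root of
    unity. *)
Definition fdeg := ex_minn fdeg_proof.

Lemma fdegP : [/\ (0 < fdeg)%N, (Q ^ fdeg = 1 %[mod p])%N &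
  forall k, (0 < k)%N -> (Q ^ k = 1 %[mod p])%N -> (fdeg <= k)%N].
Proof.
rewrite /fdeg; case: ex_minnP => f /andP[f_gt0 /eqP Qf] min_f; split=> // k k0 Qk.
by apply: min_f; rewrite k0 Qk eqxx.
Qed.

Lemma expn_card_inj : {in gtn fdeg &, forall i j,
  (Q ^ i = Q ^ j %[mod p])%N -> i = j}.
Proof.
move=> i j; wlog le_ij : i j / (i <= j)%N.
  move=> IH ltif ltjf eq_ij; have [|/ltnW] := leqP i j => /IH-> //.
move=> _ ltjf eq_ij; have [_ _ min_f] := fdegP.
apply/eqP; rewrite eqn_leq le_ij /= leqNgt -subn_gt0; apply/negP=> gt0.
have/(min_f _ gt0) : (Q ^ (j - i) = 1 %[mod p])%N.
  apply/eqP; rewrite eqn_mod_dvd ?expn_gt0 ?(ltnW (finNzRing_gt1 F)) //.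
  have co : coprime p (Q ^ i) by rewrite coprime_sym coprimeXl ?coprime_card_field.
  rewrite -(Gauss_dvdr _ co) mulnBr muln1 -expnD subnKC // -eqn_mod_dvd.
    by rewrite eq_ij.
  by rewrite leq_exp2l ?finNzRing_gt1.
by rewrite leqNgt (leq_ltn_trans (leq_subr _ _)).
Qed.

(** * Galois conjugates of roots of unity, and simple modules *)

Variables (K : closedFieldType) (iota : {rmorphism F -> K}) (zeta : K).
Hypothesis prim_zeta : p.-primitive_root zeta.

Lemma FK : [pchar K].-nat Q.
Proof. by rewrite (eq_pnat _ (fmorph_pchar iota)). Qed.

Local Notation phi := (frob FK).

Lemma phi_iota x : phi (iota x) = iota x.
Proof. by rewrite /frob -rmorphXn /= expf_card. Qed.

(** A fixed point is a root of [X^Q - X], which already splits over [F]. *)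
Lemma phi_fixed a : phi a = a -> exists x, a = iota x.
Proof.
rewrite /frob => aQ; have /(congr1 (map_poly iota)) := finField_genPoly F.
rewrite rmorphB /= map_polyXn map_polyX rmorph_prod /= => /(congr1 (horner^~ a)).
rewrite !hornerE aQ subrr horner_prod => /esym/eqP/prodf_eq0[x _].
by rewrite rmorphB /= map_polyX map_polyC !hornerE subr_eq0 => /eqP; exists x.
Qed.

(** The minimal polynomial over [F] if [eta] is a primitive [p]-th root of unity, but
    [('X - 1) ^+ fdeg] if [eta = 1]; the degree is [fdeg] in all cases. *)
Definition conj_poly (eta : K) : {poly K} :=
  \prod_(i < fdeg) ('X - (eta ^+ (Q ^ i))%:P).

(** Descent to [F], coefficient by coefficient; the default 0 never occurs when [eta ^+ p = 1]. *)
Definition conj_polyF (eta : K) : {poly F} := \poly_(i < fdeg.+1)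
  odflt 0 [pick x : F | iota x == (conj_poly eta)`_i].

(** Frobenius permutes the linear factors cyclically, as [Q ^ fdeg = 1] modulo [p]; so it fixes the
    coefficients, which then lie in [F]. *)
Lemma conj_polyFP eta : eta ^+ p = 1 ->
  [/\ conj_polyF eta \is monic, size (conj_polyF eta) = fdeg.+1 &
    map_poly iota (conj_polyF eta) = conj_poly eta].
Proof.
move=> eta_p; have [f_gt0 Qf _] := fdegP.
have fix_h : map_poly phi (conj_poly eta) = conj_poly eta.
  rewrite /conj_poly rmorph_prod /=.
  under eq_bigr do rewrite rmorphB /= map_polyX map_polyC /= /frob -exprM -expnSr.
  case: fdeg f_gt0 Qf => // f _ Qf; rewrite big_ord_recr [RHS]big_ord_recl mulrC /=.
  congr (_ * _); rewrite expn0 expr1 -(expr_mod _ eta_p) Qf.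
  by rewrite expr_mod.
have sz : size (conj_poly eta) = fdeg.+1.
  by rewrite /conj_poly size_prod_XsubC /index_enum -enumT size_enum_ord.
suff gE : map_poly iota (conj_polyF eta) = conj_poly eta.
  split=> //; last by rewrite -(size_map_poly iota) gE.
  by rewrite -(map_monic iota) gE monic_prod_XsubC.
apply/polyP=> i; rewrite coef_map coef_poly; case: ltnP => [_|le].
  case: pickP => [x /eqP // | no_x].
  have [|x def_x] := @phi_fixed (conj_poly eta)`_i.
    by rewrite -[in RHS]fix_h coef_map.
  by have := no_x x; rewrite def_x eqxx.
by rewrite raddf0 nth_default ?sz.
Qed.

(** Modulo the kernel [E] is cyclic, so it acts through powers of one [A] with [A ^+ p = 1]. Some
    conjugate polynomial is singular at [A], hence zero there by Schur's lemma. *)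
Lemma abelem_irr_conj_poly (gT : finGroupType) (E : {group gT}) n
    (rE : mx_representation F E n.+1) :
  p.-abelem E -> mx_irreducible rE ->
  exists A g, [/\ g \is monic, size g = fdeg.+1, horner_mx A g = 0 &
    forall e, e \in E -> exists k, rE e = A ^+ k].
Proof.
move=> abelE irrE; have cEE := abelem_abelian abelE.
have irrQ : mx_irreducible (kquo_repr rE) by apply/quo_mx_irr.
have cycQ : cyclic (E / rker rE)%g.
  apply: mx_faithful_irr_abelian_cyclic (kquo_mx_faithful _) irrQ _.
  exact: quotient_abelian.
have /cyclicP[xb defQ] := cycQ.
have : xb \in (E / rker rE)%g by rewrite defQ cycle_id.
case/morphimP=> x Nx Ex def_x; pose A := rE x.
have powA e : e \in E -> exists k, rE e = A ^+ k.
  move=> Ee; have /cycleP[k] : coset (rker rE) e \in <[xb]>%g.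
    by rewrite -defQ mem_quotient.
  move=> ek; exists k; have Ne := subsetP (rker_norm rE) e Ee.
  rewrite -(kquo_repr_coset rE Ee) ek def_x -morphX //.
  rewrite kquo_repr_coset ?groupX // /A.
  by elim: k {ek} => [|k IHk]; rewrite ?repr_mx1 // expgS exprS repr_mxM ?groupX ?IHk.
have Ap : A ^+ p = 1.
  have -> : A ^+ p = rE (x ^+ p)%g.
    by elim: (p) => [|k IHk]; rewrite ?repr_mx1 // expgS exprS repr_mxM ?groupX ?IHk.
  by have [_ ->] // := abelemP p_pr abelE; rewrite repr_mx1.
have zetap j : (zeta ^+ j) ^+ p = 1.
  by rewrite exprAC (prim_expr_order prim_zeta) expr1n.
suff /existsP[j Aj] :
    [exists j : 'I_p, horner_mx A (conj_polyF (zeta ^+ j)) \notin unitmx].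
  have [mon_g sz_g gE] := conj_polyFP (zetap j).
  exists A, (conj_polyF (zeta ^+ j)); split=> //.
  apply/eqP; apply: contraR Aj => nz; apply: (mx_Schur irrE) => //.
  apply/centgmxP=> e /powA[k ->]; rewrite mulmxE.
  by rewrite -[A in A ^+ k](horner_mx_X A) -rmorphXn -!rmorphM mulrC.
apply: contraT; rewrite negb_exists => /forallP unitA.
have: horner_mx A (\prod_(j < p) conj_polyF (zeta ^+ j)) \in unitmx.
  rewrite rmorph_prod; apply: (big_ind (fun B : 'M[F]_n.+1 => B \in unitmx)).
  - exact: unitmx1.
  - by move=> B C uB uC; rewrite -mulmxE unitmx_mul uB.
  by move=> j _; have := unitA j; rewrite negbK.
suff -> : horner_mx A (\prod_(j < p) conj_polyF (zeta ^+ j)) = 0.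
  by rewrite -[_ \in _]/(_ \is a GRing.unit) unitr0.
apply/eqP; rewrite -(map_mx_eq0 iota); apply/eqP; rewrite map_horner_mx rmorph_prod /=.
under eq_bigr => j _ do rewrite (let: And3 _ _ E := conj_polyFP (zetap j) in E).
(* The factors with [i = 0] multiply to [X^p - 1], which kills [A]. *)
have [f_gt0 _ _] := fdegP; rewrite /conj_poly; case: fdeg f_gt0 => // f _.
under eq_bigr => j _ do rewrite big_ord_recl expn0 expr1.
rewrite big_split /= -(big_mkord xpredT (fun i => 'X - (zeta ^+ i)%:P)).
rewrite factor_Xn_sub_1 // rmorphM rmorphB rmorphXn rmorph1 /= horner_mx_X.
by rewrite -rmorphXn Ap rmorph1 subrr mul0r.
Qed.

(** As [A] is a root of a monic polynomial of degree [fdeg], the vectors [u *m A ^+ i] with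
    [i < fdeg] span a nonzero submodule, which is everything. *)
Lemma abelem_irr_dim (gT : finGroupType) (E : {group gT}) n
    (rE : mx_representation F E n) :
  p.-abelem E -> mx_irreducible rE -> (n <= fdeg)%N.
Proof.
move=> abelE irrE; case: n => [//|n] in rE irrE *.
have [A [g [mon_g sz_g gA powA]]] := abelem_irr_conj_poly abelE irrE.
have [f_gt0 _ _] := fdegP.
have [_ irr] := (mx_irrP rE).1 irrE.
pose u : 'rV[F]_n.+1 := delta_mx 0 0.
pose W := \matrix_(i < fdeg) (u *m A ^+ i).
have W_A k : (k < fdeg)%N -> (u *m A ^+ k <= W)%MS.
  move=> lt_kf; rewrite (_ : u *m _ = row (Ordinal lt_kf) W) ?row_sub //.
  by rewrite rowK.
have W_Af : (u *m A ^+ fdeg <= W)%MS.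
  have : \sum_(i < fdeg.+1) g`_i *: A ^+ i = 0.
    rewrite -[RHS]gA -[in RHS](coefK g) poly_def sz_g rmorph_sum /=.
    by apply: eq_bigr => i _; rewrite horner_mxZ rmorphXn /= horner_mx_X.
  have gf : g`_fdeg = 1 by have /eqP := mon_g; rewrite /lead_coef sz_g.
  rewrite big_ord_recr /= gf scale1r addrC => /(canRL (addrK _)) ->.
  rewrite sub0r mulmxN eqmx_opp mulmx_sumr summx_sub // => i _.
  by rewrite -scalemxAr scalemx_sub // W_A.
have WA k : (W *m A ^+ k <= W)%MS.
  elim: k => [|k IHk]; first by rewrite expr0 mulmx1.
  rewrite exprSr -mulmxE mulmxA; apply: submx_trans (submxMr _ IHk) _.
  apply/row_subP=> i; rewrite row_mul rowK -mulmxA mulmxE -exprSr.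
  have [->|ne_i] := eqVneq i.+1 fdeg; first exact: W_Af.
  by rewrite W_A // ltn_neqAle ne_i ltn_ord.
have /irr : mxmodule rE <<W>>%MS.
  rewrite (eqmx_module rE (genmxE W)); apply/mxmoduleP=> e /powA[k ->].
  exact: WA.
rewrite /row_full !genmxE => full_W.
rewrite -(eqP (full_W _)) ?rank_leq_row // -mxrank_eq0 genmxE mxrank_eq0.
apply/eqP=> W0; have := W_A 0%N f_gt0; rewrite W0 => /submx0null.
rewrite expr0 mulmx1 => /rowP/(_ 0).
by rewrite !mxE !eqxx => /eqP; rewrite oner_eq0.
Qed.

Lemma abelem_simple_rank (gT : finGroupType) (E : {group gT}) n
    (rE : mx_representation F E n) (M : 'M_n) :
  p.-abelem E -> mxsimple rE M -> (\rank M <= fdeg)%N.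
Proof.
move=> abelE simM; have [modM _ _] := simM.
by apply: (abelem_irr_dim (rE := submod_repr modM)) => //; apply/submod_mx_irr.
Qed.

(** Apply Frobenius to the coordinates of an eigenvector; the entries of [A] are fixed. *)
Lemma eigen_phi n (A : 'M[F]_n) a :
  eigenvalue (map_mx iota A) a -> eigenvalue (map_mx iota A) (phi a).
Proof.
case/eigenvalueP=> v vA nz_v; apply/eigenvalueP; exists (map_mx phi v).
  rewrite -map_mxZ -vA map_mxM; congr (_ *m _); apply/matrixP=> i j.
  by rewrite !mxE; exact/esym/phi_iota.
by rewrite map_mx_eq0.
Qed.

(* An element of the derived subgroup acts with determinant 1 on the
   eigenspace, while it acts there as the scalar [zeta ^+ k]. *)
Lemma dvd_rank_eigenspace n (P : {group {'GL_n[F]}}) z k :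
  z \in 'Z(P)%g -> z \in P^`(1)%g -> ~~ (p %| k)%N ->
  (p %| \rank (eigenspace (map_mx iota (GLval z)) (zeta ^+ k)))%N.
Proof.
case/centerP=> Pz cPz P'z k'p; set U := eigenspace _ _.
pose rK := map_repr iota (GL_repr P).
have modU : mxmodule rK U.
  apply/mxmoduleP=> g Pg; apply/eigenspaceP; rewrite -mulmxA.
  rewrite -[rK g *m _]map_mxM -GL_MxE -cPz // GL_MxE map_mxM mulmxA.
  by rewrite (eigenspaceP (submx_refl _)) -scalemxAl.
(* [D] is a subgroup containing all commutators, hence the derived subgroup. *)
pose rU := submod_repr modU; pose D := [set g in P | \det (rU g) == 1].
have gD : group_set D.
  apply/group_setP; rewrite inE group1 repr_mx1 det1 eqxx; split=> // x y.
  rewrite !inE => /andP[Px /eqP dx] /andP[Py /eqP dy].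
  by rewrite groupM ?repr_mxM ?det_mulmx ?dx ?dy ?mulr1 /=.
have /subsetP/(_ z P'z) : (P^`(1) \subset Group gD)%g.
  rewrite gen_subG; apply/subsetP=> _ /imset2P[x y Px Py ->].
  rewrite inE groupR //= commgEl conjgE !repr_mxM ?groupM ?groupV //.
  rewrite !repr_mxV ?groupV // !det_mulmx !det_inv.
  have u g : g \in P -> \det (rU g) != 0.
    by move=> Pg; have := repr_mx_unit rU Pg; rewrite unitmxE unitfE.
  by apply/eqP; field; rewrite !u.
have rUz : rU z = (zeta ^+ k)%:M.
  apply: (can_inj (val_submodK (U := U))).
  rewrite -[rU z]mul1mx val_submodJ // -[in RHS]scalemx1 linearZ /=.
  exact: (eigenspaceP (val_submodP (U := U) 1%:M)).
rewrite inE Pz rUz det_scalar -exprM => /eqP/eqP.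
by rewrite -(prim_order_dvd prim_zeta) Euclid_dvdM // (negPf k'p).
Qed.

(** A nontrivial eigenvalue of [z] has [fdeg] distinct conjugates. Their eigenspaces are
    independent, lie in the image of [z - 1], and have positive dimension divisible by [p]. *)
Lemma rank_central_commutator n (P : {group {'GL_n[F]}}) z :
  z \in 'Z(P)%g -> z \in P^`(1)%g -> #[z]%g = p ->
  (p * fdeg <= \rank (GLval z - 1)%R)%N.
Proof.
move=> Zz P'z oz; set zK := map_mx iota (GLval z).
have zp : zK ^+ p = 1.
  by rewrite -[zK ^+ p]rmorphXn -GL_X -oz expg_order rmorph1.
have [k k'p eig_k] : exists2 k, ~~ (p %| k)%N & eigenvalue zK (zeta ^+ k).
  (* Otherwise every factor of [X^p - 1] except [X - 1] is invertible at [z], so [z = 1]. *)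
  suff /existsP[k /andP[k_gt0 eig_k]] :
      [exists k : 'I_p, (0 < k)%N && eigenvalue zK (zeta ^+ k)].
    by exists (k : nat) => //; rewrite gtnNdvd.
  apply: contraT; rewrite negb_exists => /forallP no_eig.
  have : horner_mx zK ('X^p - 1) = 0.
    by rewrite rmorphB rmorphXn rmorph1 /= horner_mx_X zp subrr.
  rewrite -(factor_Xn_sub_1 prim_zeta) big_ltn ?prime_gt0 // expr0.
  rewrite rmorphM rmorphB /= horner_mx_X horner_mx_C rmorph_prod /=.
  rewrite -mulmxE; set B := \prod_(_ <= _ < _) _ => zKB.
  have uB : B \in unitmx.
    rewrite /B big_nat_cond; apply: (big_ind (fun C => C \in unitmx)).
    - exact: unitmx1.
    - by move=> C D uC uD; rewrite -mulmxE unitmx_mul uC.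
    move=> i; rewrite andbT => /andP[i_gt0 lt_ip].
    have := no_eig (Ordinal lt_ip); rewrite /= i_gt0 negbK /=.
    by rewrite kermx_eq0 row_free_unit rmorphB /= horner_mx_X horner_mx_C.
  have /eqP := congr1 (mulmx^~ (invmx B)) zKB.
  rewrite mulmxK // mul0mx -(map_mx1 iota) -map_mxB map_mx_eq0 subr_eq0 => /eqP z1.
  have z1' : z = 1%g by apply/val_inj.
  by have := prime_gt1 p_pr; rewrite -oz z1' order1.
have eig i : eigenvalue zK (zeta ^+ (k * Q ^ i)).
  elim: i => [|i IHi]; first by rewrite expn0 muln1.
  by rewrite expnSr mulnA exprM; apply: eigen_phi.
have k'pi i : ~~ (p %| k * Q ^ i)%N.
  by rewrite Gauss_dvdl // coprime_sym coprimeXl // coprime_card_field.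
have prim_k : p.-primitive_root (zeta ^+ k).
  by rewrite (prim_root_exp_coprime _ prim_zeta) coprime_sym prime_coprime.
have inj : {in xpredT &, injective (fun i : 'I_fdeg => zeta ^+ (k * Q ^ i))}.
  move=> i j _ _ /eqP; rewrite !exprM (eq_prim_root_expr prim_k) => /eqP eq_ij.
  by apply/val_inj/expn_card_inj; rewrite ?inE ?ltn_ord.
have := mxdirect_sum_eigenspace zK inj => /mxdirectP /= rk.
have le : (\sum_(i < fdeg) eigenspace zK (zeta ^+ (k * Q ^ i)) <= zK - 1)%MS.
  apply/sumsmx_subP=> i _; set a := zeta ^+ _; set W := eigenspace _ _.
  have nz_a : a - 1 != 0 by rewrite subr_eq0 -(prim_order_dvd prim_zeta).
  have -> : W = ((a - 1)^-1 *: W) *m (zK - 1).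
    have WzK : W *m zK = a *: W by apply/eigenspaceP.
    rewrite -scalemxAl mulmxBr mulmx1 WzK -{3}[W]scale1r.
    by rewrite -scalerBl scalerA mulVf ?scale1r.
  exact: submxMl.
have := mxrankS le; rewrite rk -[1](map_mx1 iota) -map_mxB mxrank_map; apply: leq_trans.
rewrite mulnC -[X in (X * _)%N]card_ord -sum_nat_const; apply: leq_sum => i _.
apply: dvdn_leq; last exact: (dvd_rank_eigenspace Zz P'z (k'pi i)).
by rewrite lt0n mxrank_eq0; exact: eig.
Qed.

(** The nilpotent group generated by [x] and [y] has a central [z] of order [p] in its derived
    subgroup. As [z] fixes all common fixed vectors of [x] and [y], the rank of [z - 1] is at most
    the sum of the two ranks. *)
Lemma noncommuting_rank n (S : {group {'GL_n[F]}}) x y :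
  p.-group S -> x \in S -> y \in S -> ~ commute x y ->
  (p * fdeg <= \rank (GLval x - 1)%R + \rank (GLval y - 1)%R)%N.
Proof.
move=> pS Sx Sy ncxy; pose P := <<[set x; y]>>%G.
have sPS : P \subset S by rewrite gen_subG subUset !sub1set Sx.
have pP := pgroupS sPS pS; have nilP := pgroup_nil pP.
have [Px Py] : x \in P /\ y \in P by rewrite !mem_gen ?set21 ?set22.
have ntP' : P^`(1)%g != 1%g.
  apply/eqP=> /commG1P cPP; apply: ncxy.
  exact: (centP (subsetP cPP x Px)).
have ntZ : (P^`(1) :&: 'Z(P) != 1)%g by rewrite meet_center_nil // der_normal.
have pZ : p.-group (P^`(1) :&: 'Z(P))%g.
  by apply: pgroupS pP; rewrite subIset // der_sub.
have [_ p_dvd _] := pgroup_pdiv pZ ntZ.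
have [z /setIP[P'z Zz] oz] := Cauchy p_pr p_dvd.
apply: leq_trans (rank_central_commutator Zz P'z oz) _.
pose W := (kermx (GLval x - 1)%R :&: kermx (GLval y - 1)%R)%MS.
have sPW : P \subset rstab (GL_repr P) W.
  rewrite gen_subG; apply/subsetP=> g; rewrite !inE.
  have fixW u : (W <= kermx (GLval u - 1)%R)%MS -> W *m GLval u == W.
    by move/sub_kermxP; rewrite mulmxBr mulmx1 => /eqP; rewrite subr_eq0.
  by case/orP=> /eqP->; rewrite ?Px ?Py fixW ?capmxSl ?capmxSr.
have Pz : z \in P by apply: (subsetP (der_sub 1 _)).
have Wz : (W <= kermx (GLval z - 1)%R)%MS.
  have := subsetP sPW z Pz; rewrite inE => /andP[_ /eqP fixW].
  by apply/sub_kermxP; rewrite mulmxBr mulmx1; apply/eqP; rewrite subr_eq0; apply/eqP.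
have arith N a b c w s : (w <= N - c -> s + w = N - a + (N - b) -> s <= N ->
    a <= N -> b <= N -> c <= N -> c <= a + b)%N by clear; lia.
have := mxrankS Wz; rewrite mxrank_ker => /arith; apply; last exact: rank_leq_row.
- by rewrite -!mxrank_ker; apply: mxrank_sum_cap.
- exact: rank_leq_col.
- exact: rank_leq_row.
exact: rank_leq_row.
Qed.

End CrossCharacteristic.

(** * Cross characteristic: maximal elementary abelian subgroups *)

Section MaximalElementaryAbelian.
Local Open Scope ring_scope.
Variables (F : finFieldType) (sigma : {rmorphism F -> F}) (n p f : nat).
Hypothesis sigmaK : involutive sigma.
Local Notation U := (usubset sigma n).
Local Notation adj := (adjmx sigma).
Variable E : {group {'GL_n[F]}}.
Hypotheses (sEU : E \subset U) (cEE : abelian E).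
Hypothesis expE : forall e, e \in E -> (e ^+ p = 1)%g.
Hypothesis maxE : forall x, x \in U -> x \in 'C(E)%g -> (x ^+ p = 1)%g -> x \in E.
Hypothesis F'E : [pchar F]^'.-group E.
Local Notation rE := (GL_repr E).
Hypothesis simple_rank : forall M : 'M_n.-1.+1, mxsimple rE M -> (\rank M <= f)%N.
Implicit Types P M W : 'M[F]_n.-1.+1.

(** Orthogonal projections commuting with [E]; they encode the nondegenerate invariant subspaces. *)
Definition orthproj P := [/\ P *m P = P, adj P = P &
  forall e, e \in E -> P *m GLval e = GLval e *m P].

(** For a projection [P], this acts as [A] on the image of [P] and as the identity on its kernel. *)
Definition restr P (A : 'M[F]_n.-1.+1) := 1 + P *m (A - 1).

Lemma restrM P A B : P *m P = P -> P *m A = A *m P ->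
  restr P A *m restr P B = restr P (A *m B).
Proof.
rewrite /restr !mulmxE => PP PA.
have Pa : P * (A - 1) = (A - 1) * P by rewrite mulrBr mulrBl PA mulr1 mul1r.
have -> : A * B - 1 = (B - 1) + ((A - 1) + (A - 1) * (B - 1)).
  by rewrite -{1}[A - 1]mulr1 -mulrDr [1 + _]addrC subrK mulrBl mul1r [RHS]addrC addrA subrK.
move: (A - 1) (B - 1) Pa => a b Pa.
rewrite mulrDl mul1r [P * a * _]mulrDr mulr1 [X in X * (P * b)]Pa.
rewrite -(mulrA a) (mulrA P P) PP (mulrA a) -Pa -(mulrA P).
by rewrite !mulrDr -addrA.
Qed.

Lemma restr_conj P e g : orthproj P -> e \in E -> g \in E ->
  restr P (GLval e) *m GLval g = GLval g *m restr P (GLval e).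
Proof.
move=> [_ _ cP] Ee Eg; have := cP g Eg.
rewrite /restr !mulmxE mulrDl [_ * (1 + _)]mulrDr mul1r mulr1 mulrA => <-.
rewrite -!mulrA; congr (_ + P * _); rewrite mulrBl mulrBr mul1r mulr1 -!GL_ME.
by rewrite (centP (subsetP cEE e Ee) g Eg).
Qed.

(** The restricted element is unitary, centralizes [E] and has [p]-th power 1, so [maxE] puts it in
    [E]. *)
Lemma restr_mem P e : orthproj P -> e \in E ->
  exists2 x, x \in E & GLval x = restr P (GLval e).
Proof.
move=> oP Ee; have [PP aP cP] := oP.
have /unitaryP Ue := subsetP sEU e Ee.
have [|x Ux def_x] := @unitary_lift _ sigma n (restr P (GLval e)).
  have -> : adj (restr P (GLval e)) = restr P (adj (GLval e)).
    rewrite /restr adjmxD adjmx1 adjmxM aP adjmxB adjmx1; congr (_ + _).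
    rewrite mulmxBl mulmxBr mul1mx mulmx1; congr (_ - _).
    have := congr1 (@adjmx _ sigma _ _) (cP e Ee); rewrite !adjmxM aP; exact.
  by rewrite restrM ?cP // Ue /restr subrr mulmx0 addr0.
exists x => //; apply: maxE => //.
  apply/centP=> g Eg; apply/val_inj.
  change (GLval x *m GLval g = GLval g *m GLval x).
  by rewrite def_x restr_conj.
apply/val_inj; change (GLval (x ^+ p)%g = 1).
have Xx k : GLval (x ^+ k)%g = restr P (GLval (e ^+ k)%g).
  elim: k => [|k IHk]; first by rewrite /restr GL_1E subrr mulmx0 addr0.
  by rewrite !expgS !GL_MxE def_x IHk restrM ?cP.
by rewrite Xx expE // /restr GL_1E subrr mulmx0 addr0.
Qed.

Lemma perp_module m (W : 'M_(m, n.-1.+1)) :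
  mxmodule rE W -> mxmodule rE (kermx (adj W)).
Proof.
move=> /mxmoduleP modW; apply/mxmoduleP=> e Ee; apply/sub_kermxP.
have /submxP[X defX] := modW _ (groupVr Ee).
have /unitaryP Ue := subsetP sEU e Ee.
have -> : kermx (adj W) *m rE e *m adj W = kermx (adj W) *m adj (W *m rE e^-1%g).
  rewrite adjmxM -mulmxA; congr (_ *m _).
  have /unitaryP Ue' := subsetP sEU _ (groupVr Ee).
  have {Ue'} : adj (GLval e^-1%g) = GLval e.
    by rewrite -[RHS]mulmx1 -Ue' mulmxA -GL_MxE mulgV GL_1E mul1mx.
  by rewrite /= => ->.
by rewrite defX adjmxM mulmxA mulmx_ker mul0mx.
Qed.

(** Project along the orthogonal of [W]. Then [(1 - P) *m adj P = 0], so [adj P = P *m adj P], and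
    taking adjoints gives [P = adj P]. *)
Lemma orthproj_nondeg W : mxmodule rE W -> (W :&: kermx (adj W))%MS = 0 ->
  exists2 P, orthproj P & (P :=: W)%MS.
Proof.
move=> modW tiW; pose V := kermx (adj W); pose P := proj_mx W V.
have modV : mxmodule rE V := perp_module modW.
have fullWV : (1%:M <= W + V)%MS.
  rewrite sub1mx /row_full (mxrank_disjoint_sum tiW) mxrank_ker mxrank_adjmx.
  by rewrite subnKC ?rank_leq_col.
have PW : (P <= W)%MS by rewrite -[P]mul1mx proj_mx_sub.
have QV : (1 - P <= V)%MS by rewrite -{1}[P]mul1mx proj_mx_compl_sub.
have P_W m (A : 'M_(m, _)) : (A <= W)%MS -> A *m P = A by apply: proj_mx_id.
have P_V m (A : 'M_(m, _)) : (A <= V)%MS -> A *m P = 0 by apply: proj_mx_0.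
clearbody P; exists P; last by apply/eqmxP; rewrite PW -{1}(P_W _ W) ?submxMl.
split; first exact: P_W.
  have [X defP] := submxP PW.
  have : (1 - P) *m adj P = 0.
    by have /sub_kermxP QW := QV; rewrite defP adjmxM mulmxA -defP QW mul0mx.
  rewrite mulmxBl mul1mx => /eqP; rewrite subr_eq0 => /eqP aP.
  by rewrite aP; have := congr1 (@adjmx _ sigma _ _) aP; rewrite adjmxM !(adjmxK sigmaK) => <-.
move=> e Ee; transitivity (((1 - P) *m GLval e + P *m GLval e) *m P).
  rewrite [RHS]mulmxDl P_V ?add0r ?P_W //; first exact: (mxmodule_trans modW Ee).
  exact: (mxmodule_trans modV Ee).
by rewrite -mulmxDl subrK mul1mx.
Qed.

Lemma orthproj_module P : orthproj P -> mxmodule rE P.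
Proof.
by move=> [_ _ cP]; apply/mxmoduleP=> e Ee; rewrite [rE e]/(GLval e) cP ?submxMl.
Qed.

(** A simple submodule is nondegenerate or totally isotropic. In the second case, semisimplicity of
    [P] gives a simple [M'] not orthogonal to [M]; either [M'] is nondegenerate or [M + M'] is. *)
Lemma small_nondeg P : orthproj P -> P != 0 -> exists W,
  [/\ mxmodule rE W, (W <= P)%MS, W != 0, (W :&: kermx (adj W))%MS = 0 &
      (\rank W <= 2 * f)%N].
Proof.
move=> oP nzP; have modP := orthproj_module oP; have [PP aP cP] := oP.
(* A boolean goal, because simple submodules and semisimple decompositions exist only under
   [classically]. *)
suff /existsP[W /and5P[modW sWP nzW /eqP tiW rkW]] :
    [exists W : 'M[F]_n.-1.+1, [&& mxmodule rE W, (W <= P)%MS, W != 0,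
       (W :&: kermx (adj W))%MS == 0 & (\rank W <= 2 * f)%N]].
  by exists W.
have perp_sym m1 m2 (A : 'M_(m1, n.-1.+1)) (B : 'M_(m2, n.-1.+1)) :
    (A <= kermx (adj B))%MS -> (B <= kermx (adj A))%MS.
  move=> /sub_kermxP AB; apply/sub_kermxP; rewrite -[LHS](adjmxK sigmaK).
  by rewrite adjmxM (adjmxK sigmaK) AB adjmx0.
have dich M (W : 'M_n.-1.+1) : mxsimple rE M -> mxmodule rE W ->
    (M :&: W)%MS = 0 \/ (M <= W)%MS.
  move=> [modM _ simM] modW; have [->|nz] := eqVneq (M :&: W)%MS 0; first by left.
  right; apply: submx_trans (capmxSr M W).
  by apply: simM; rewrite ?capmxSl ?capmx_module.
have rank_f M : mxsimple rE M -> (\rank M <= 2 * f)%N.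
  by move/simple_rank=> leM; rewrite mul2n -addnn (leq_trans leM) ?leq_addr.
apply: (mxsimple_exists modP nzP) => [[M simM sMP]].
have [modM nzM _] := simM; have modMp := perp_module modM.
have [tiM|isoM] := dich M _ simM modMp; first by
  apply/existsP; exists M; rewrite modM sMP nzM tiM eqxx rank_f.
have redP := mx_reducibleS modP (submx1 P) (mx_Maschke_pchar rE F'E).
apply: (mx_reducible_semisimple modP redP) => ssP.
have [M' [simM' sM'P nperpM']] : exists M', [/\ mxsimple rE M', (M' <= P)%MS &
    ~~ (M' <= kermx (adj M))%MS].
  case: ssP => I V /= simV defP _.
  have [/forallP sVM | ] := boolP [forall i, V i <= kermx (adj M)]%MS; last first.
    rewrite negb_forall => /existsP[i nVM].
    by exists (V i); split; rewrite // -defP (sumsmx_sup i).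
  (* If [M] were orthogonal to all of [P], then [M = M *m P = M *m adj P = 0]. *)
  have : (P <= kermx (adj M))%MS by rewrite -defP; apply/sumsmx_subP=> i _.
  move/perp_sym/sub_kermxP; rewrite aP; have [X defM] := submxP sMP.
  by rewrite {1}defM -mulmxA PP -defM => M0; rewrite M0 eqxx in nzM.
have [modM' nzM' _] := simM'; have modM'p := perp_module modM'.
have [tiM'|isoM'] := dich M' _ simM' modM'p; first by
  apply/existsP; exists M'; rewrite modM' sM'P nzM' tiM' eqxx rank_f.
have tiM'M : (M' :&: kermx (adj M))%MS = 0.
  by have [//|sM'M] := dich M' _ simM' modMp; rewrite sM'M in nperpM'.
have tiMM' : (M :&: kermx (adj M'))%MS = 0.
  have [//|/perp_sym sM'M] := dich M _ simM modM'p; by rewrite sM'M in nperpM'.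
apply/existsP; exists (M + M')%MS; apply/and5P; split.
- exact: addsmx_module.
- by rewrite addsmx_sub sMP.
- by apply: contraNneq nzM => MM0; rewrite -submx0 -MM0 addsmxSl.
(* Since [M] is isotropic, orthogonality to [M] kills the component in [M']; orthogonality to [M']
   then kills the other. *)
- apply/rowV0P=> u; rewrite sub_capmx => /andP[/sub_addsmxP[[a b] /= ->]].
  move/perp_sym; rewrite addsmx_sub => /andP[/perp_sym uM /perp_sym uM'].
  have aM : (a *m M <= kermx (adj M))%MS by apply: submx_trans isoM; rewrite submxMl.
  have bM0 : b *m M' = 0.
    apply/eqP; rewrite -submx0 -tiM'M sub_capmx submxMl /=.
    by rewrite -[b *m M'](addKr (a *m M)) addmx_sub // eqmx_opp.
  rewrite bM0 addr0 in uM' *; apply/eqP.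
  by rewrite -submx0 -tiMM' sub_capmx submxMl.
apply: leq_trans (mxrank_adds_leqif _ _) _; rewrite mul2n -addnn.
by rewrite leq_add // simple_rank.
Qed.

(** Split off a small nondegenerate piece: [restr P e] is the product of [restr P1 e] and
    [restr (P - P1) e], both in [E]. The rank of [P] drops, and [P = 1] gives [e] itself. *)
Lemma maximal_abelem_gen :
  E \subset <<[set x in E | \rank (GLval x - 1)%R <= 2 * f]%N>>%g.
Proof.
set D := <<_>>%g.
suff step k P e x : (\rank P < k)%N -> orthproj P -> e \in E ->
    GLval x = restr P (GLval e) -> x \in D.
  apply/subsetP=> e Ee; apply: (step _ 1 e e (ltnSn _)) => //; last first.
    by rewrite /restr mul1mx addrC subrK.
  by split=> [||g _]; rewrite ?mul1mx ?mulmx1 ?adjmx1.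
elim: k => // k IHk in P x *; rewrite ltnS => le_k oP Ee def_x.
have [PP aP cP] := oP.
have [P0|nzP] := eqVneq P 0.
  suff -> : x = 1%g by apply: group1.
  apply/val_inj; change (GLval x = 1).
  by rewrite def_x /restr P0 mul0mx addr0.
have [W [modW sWP nzW tiW rkW]] := small_nondeg oP nzP.
have [P1 oP1 eqP1] := orthproj_nondeg modW tiW; have [PP1 aP1 cP1] := oP1.
have P1P : P1 *m P = P1.
  have /submxP[X ->] : (P1 <= P)%MS by rewrite eqP1.
  by rewrite -mulmxA PP.
have PP1' : P *m P1 = P1.
  by have := congr1 (@adjmx _ sigma _ _) P1P; rewrite adjmxM aP1 aP.
have oP2 : orthproj (P - P1).
  split; last 1 first.
  - by move=> g Eg; rewrite mulmxBl mulmxBr cP // cP1.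
  - by rewrite mulmxBl !mulmxBr PP PP1 P1P PP1' subrr subr0.
  by rewrite adjmxB aP aP1.
have [x1 Ex1 def_x1] := restr_mem oP1 Ee.
have [x2 Ex2 def_x2] := restr_mem oP2 Ee.
have -> : x = (x1 * x2)%g.
  apply/val_inj; change (GLval x = GLval (x1 * x2)%g).
  have [_ _ /(_ e Ee) cP2] := oP2.
  have {cP2} : (P - P1) * (GLval e - 1) = (GLval e - 1) * (P - P1).
    by rewrite [LHS]mulrBr [RHS]mulrBl mulr1 mul1r -!mulmxE cP2.
  rewrite GL_ME def_x def_x1 def_x2 /restr !mulmxE.
  move: (GLval e - 1) => a cP2.
  rewrite mulrDl mul1r [P1 * a * _]mulrDr mulr1 !mulrA -(mulrA P1).
  rewrite -cP2 !mulrA mulrBr -!mulmxE P1P PP1 subrr !mul0mx addr0 -addrA -mulmxDl.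
  by rewrite subrK.
rewrite groupM //.
  apply: mem_gen; rewrite inE Ex1 def_x1 /restr addrC addKr.
  by apply: leq_trans (mxrankM_maxl _ _) _; rewrite eqP1.
apply: (IHk (P - P1) x2) => //; apply: leq_trans le_k; apply: rank_ltmx.
rewrite ltmxE; have {1}-> : P - P1 = (P - P1) *m P by rewrite mulmxBl PP P1P.
rewrite submxMl; apply: contra nzW => sPP.
have /submxP[X defX] : (P1 <= P - P1)%MS by rewrite (submx_trans _ sPP) // eqP1.
rewrite -submx0 -eqP1 submx0 -PP1 {1}defX -mulmxA mulmxBl PP1 PP1' subrr mulmx0.
by [].
Qed.

End MaximalElementaryAbelian.

(** * The conjugation of a field with q^2 elements *)

Section Conjugation.
Local Open Scope ring_scope.
Variables (F : finFieldType) (q : nat).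
Hypotheses (q_gt1 : (1 < q)%N) (cardF : #|F| = (q ^ 2)%N).
Hypothesis qF : [pchar F].-nat q.

Lemma frob_involutive : involutive (frob qF).
Proof. by move=> x; rewrite /frob -exprM mulnn -cardF expf_card. Qed.

(** Otherwise [X^q - X] would have [q ^ 2] roots. *)
Lemma frob_neq_id : exists t, frob qF t != t.
Proof.
apply/existsP; apply: contraT; rewrite negb_exists => /forallP fixF.
have sz : size ('X^q - 'X : {poly F}) = q.+1.
  by rewrite size_polyDl ?size_polyXn // size_polyN size_polyX ltnS.
have := @max_poly_roots _ ('X^q - 'X : {poly F}) (enum F).
rewrite -size_poly_eq0 sz -cardE cardF enum_uniq => /(_ isT) max_q.
suff /max_q : all (root ('X^q - 'X)) (enum F) by move/(_ isT); clear -q_gt1; nia.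
apply/allP=> x _; rewrite /root !hornerE subr_eq0.
by have := fixF x; rewrite negbK.
Qed.

(** Write [a = z ^+ i] with [z] a generator of the multiplicative group. Then [q ^ 2 - 1] divides
    [i * (q - 1)], so [i = k * (q + 1)] and [t = z ^+ k] works. *)
Lemma frob_norm_onto a : frob qF a = a -> exists t, t * frob qF t = a.
Proof.
have [-> _|nz_a aq] := eqVneq a 0; first by exists 0; rewrite mul0r.
have [z prim_z] : exists z : F, (q ^ 2).-1.-primitive_root z.
  have /hasP[z _ ?] : has (q ^ 2).-1.-primitive_root (enum (predC1 (0 : F))).
    apply: has_prim_root; rewrite ?enum_uniq //; first by lia.
      apply/allP=> x; rewrite mem_enum inE => nz_x; rewrite unity_rootE.
      apply/eqP/(mulfI nz_x); rewrite mulr1 -exprS prednK ?expn_gt0; last by lia.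
      by rewrite -cardF expf_card.
    by rewrite -cardE cardC1 cardF.
  by exists z.
have aQ : a ^+ (q ^ 2).-1 = 1.
  apply: (mulfI nz_a); rewrite mulr1 -exprS prednK; last by rewrite expn_gt0; lia.
  by rewrite -cardF expf_card.
have [[i _] /= def_a] := prim_rootP prim_z aQ.
have : z ^+ (i * q) == z ^+ i by rewrite exprM -def_a; apply/eqP.
rewrite (eq_prim_root_expr prim_z) eqn_mod_dvd; last by rewrite leq_pmulr // ltnW.
have -> : (q ^ 2).-1 = ((q - 1) * (q + 1))%N by rewrite -subn_sqr subn1.
rewrite -{2}[i]muln1 -mulnBr [(i * _)%N]mulnC dvdn_pmul2l ?subn_gt0 // => /dvdnP[k def_i].
by exists (z ^+ k); rewrite /frob -exprM -exprD def_a def_i addn1 mulnS.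
Qed.

End Conjugation.

(** * The Thompson subgroup and the conclusion *)

Section Thompson.
Variables (gT : finGroupType) (p : nat) (S : {group gT}).

Lemma thompson_sub : thompson_subgroup p S \subset S.
Proof. by rewrite gen_subG; apply/bigcupsP=> E /pnElemP[]. Qed.

Lemma thompson_normal : thompson_subgroup p S <| S.
Proof.
apply/andP; split; first exact: thompson_sub.
apply: norms_gen; apply/subsetP=> x Sx; rewrite inE.
apply/subsetP=> _ /imsetP[y /bigcupP[E EpE Ey] ->].
apply/bigcupP; exists (E :^ x)%G; last by rewrite memJ_conjg.
by rewrite -{2}(conjGid Sx) pnElemJ.
Qed.

End Thompson.

(** [G] and [S] have the same [p]-rank. Maximality in all of [G] matters, since restricted elements
    are only known to be unitary, not to lie in [S]. *)
Lemma Sylow_pnElem_max (gT : finGroupType) p (G S E : {group gT}) :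
  prime p -> p.-Sylow(G) S -> E \in 'E_p^('r_p(S))(S) -> E \in 'E*_p(G).
Proof.
move=> p_pr sylS /pnElemP[sES abelE rkE]; apply/pmaxElemP; split=> [|H EpH sEH].
  by rewrite inE (subset_trans sES (pHall_sub sylS)).
have /setIdP[sHG abelH] := EpH.
apply/esym/eqP; rewrite eqEcard sEH (card_pgroup (abelem_pgroup abelH)).
rewrite (card_pgroup (abelem_pgroup abelE)) leq_exp2l ?prime_gt1 // rkE.
by rewrite (p_rank_Sylow sylS) logn_le_p_rank.
Qed.

Lemma thompson_abelian (F : finFieldType) (sigma : {rmorphism F -> F}) n p
    (S : {group {'GL_n[F]}}) :
  involutive sigma -> prime p -> 4 < p -> ([pchar F].-nat #|F|)%R ->
  (p \notin [pchar F])%R -> p.-Sylow(usubset sigma n) S ->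
  abelian (thompson_subgroup p S).
Proof.
move=> sigmaK p_pr p_gt4 FF p'F sylS.
have [K [iota _]] := countable_algebraic_closure F.
have [zeta prim_zeta] : exists z : K, (p.-primitive_root z)%R.
  apply: prim_root_exists; rewrite -(rmorph_nat iota) fmorph_eq0.
  by apply: contra p'F => p0; rewrite inE p_pr.
pose f := fdeg p_pr FF p'F.
pose T := [set x in S | \rank (GLval x - 1)%R <= 2 * f].
have sJT : thompson_subgroup p S \subset <<T>>.
  rewrite gen_subG; apply/bigcupsP=> E EpE.
  have [sES abelE _] := pnElemP EpE; have [cEE expE] := abelemP p_pr abelE.
  have sSU := pHall_sub sylS.
  have maxE := pmaxElem_LdivP p_pr
    (Sylow_pnElem_max (G := unitary_sub sigma n) p_pr sylS EpE).
  apply: subset_trans (@maximal_abelem_gen _ sigma n p f sigmaK E _ _ _ _ _ _) _ => //.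
  - exact: subset_trans sSU.
  - move=> x Ux Cx xp; rewrite -maxE; apply/LdivP; split=> //; exact/setIP.
  - apply: sub_in_pnat (abelem_pgroup abelE) => r _ /eqP->.
    exact: p'F.
  - move=> M; exact: (abelem_simple_rank p_pr FF p'F iota prim_zeta abelE).
  by rewrite genS //; apply/subsetP=> x; rewrite !inE => /andP[/(subsetP sES)-> ->].
apply: abelianS sJT _; rewrite abelian_gen.
apply/centsP=> x /setIdP[Sx rx] y /setIdP[Sy ry].
apply/commgP; apply: contraT => ncxy.
have [f_gt0 _ _] := fdegP p_pr FF p'F.
have nc : ~ commute x y by move/commgP; rewrite (negPf ncxy).
have le_pf := noncommuting_rank p_pr FF p'F iota prim_zeta
  (pHall_pgroup sylS) Sx Sy nc.
(* Two such generators that do not commute would give [p * f <= 4 * f]. *)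
have := leq_trans le_pf (leq_add rx ry); rewrite -/f -mulnDl.
by rewrite leq_pmul2r // leqNgt p_gt4.
Qed.

Theorem theorem1p2 (n p q : nat) (F : finFieldType) (S : {group {'GL_n[F]}}) :
  (1 <= n)%N -> prime p -> (5 <= p)%N -> prime_power q ->
  #|F| = (q ^ 2)%N ->
  p.-Sylow(unitary_group F q n) S ->
  exists X : {group {'GL_n[F]}},
    is_oliver_subgroup p S X /\ thompson_subgroup p S \subset X.
Proof.
move=> _ p_pr p_gt4 [r [e [r_pr [e_gt0 def_q]]]] cardF sylS.
have q_gt1 : 1 < q by rewrite def_q -(exp1n e) ltn_exp2r ?prime_gt1.
have cardF' : #|F| = (r ^ (e * 2))%N by rewrite cardF def_q expnM.
have rF := card_finPcharP cardF' r_pr.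
have natF k : ([pchar F].-nat (r ^ k)%N)%R.
  by rewrite pnatX pnatE // rF.
have qF : ([pchar F].-nat q)%R by rewrite def_q.
(* [is_oliver_subgroup] determines [X], so any witness is the Oliver subgroup. *)
have [X oliverX] := oliver_subgroup_exists p S; exists X; split=> //.
have [_ _ maxX] := oliverX; pose sigma : {rmorphism F -> F} := frob qF.
have sigmaK : involutive sigma := frob_involutive cardF qF.
have {}sylS : p.-Sylow(usubset sigma n) S by [].
have [pF|p'F] := boolP (p \in [pchar F]%R).
  apply: subset_trans (thompson_sub p S) (maxX S (normal_refl S) _).
  apply: (sylow_defining_Qseries sigmaK) => //.
  - exact: frob_neq_id q_gt1 cardF qF.
  - exact: frob_norm_onto q_gt1 cardF qF.
  exact: ltn_trans p_gt4.
have FF : ([pchar F].-nat #|F|)%R by rewrite cardF'.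
have abJ := thompson_abelian sigmaK p_pr p_gt4 FF p'F sylS.
apply: (maxX [group of thompson_subgroup p S] (thompson_normal p S)).
apply: abelian_has_Qseries (thompson_normal p S) abJ.
exact: ltn_trans p_gt4.
Qed.
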